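(* Let $R$ be a finite chain ring of characteristic a prime $p$, and let $n\ge2$. For any two elements $a(x),b(x)\in B_1$, if $a(x)$ and $b(x)$ are $n$-isometric, then either $a(x)$ and $b(x)$ are $n$-equivalent, or there exists an integer $l\ge1$ such that $p^l<n$ and $a(x)$ and $b(x)^{\star p^l}$ are $n$-equivalent.
   Context: A finite chain ring $R$ is a finite commutative local ring with identity whose ideals are linearly ordered by inclusion; $R^\times$ is its group of units. $B_1=\{b_1x+b_0\mid b_1,b_0\in R^\times\}\subset R[x]$, with coefficientwise product $(a_1x+a_0)\star(b_1x+b_0)=a_1b_1x+a_0b_0$; $b(x)^{\star N}$ is the $N$-fold $\star$-product of $b(x)$ with itself, so $(b_1x+b_0)^{\star N}=b_1^Nx+b_0^N$. Elements of $R[x]/\langle x^n-c(x)\rangle$ (with $\deg c<n$) are represented uniquely by polynomials of degree $<n$; the Hamming weight of an element is the number of nonzero coefficients of this representative, and the Hamming distance of two elements is the Hamming weight of their difference. $a(x)$ is $n$-isometric to $b(x)$ if there exists an $R$-algebra isomorphism $R[x]/\langle x^n-a(x)\rangle\to R[x]/\langle x^n-b(x)\rangle$ preserving the Hamming distance. They are $n$-equivalent if there exists $\alpha\in R^\times$ such that $f(x)\mapsto f(\alpha x)$ is a (well-defined) $R$-algebra isomorphism $R[x]/\langle x^n-a(x)\rangle\to R[x]/\langle x^n-b(x)\rangle$. *)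

(* Defs.v *)
(* MathComp world *)
From HB Require Import structures.
From mathcomp Require Import all_boot all_order all_algebra.

Set Implicit Arguments.
Unset Strict Implicit.
Unset Printing Implicit Defensive.

Import GRing.Theory.
Local Open Scope ring_scope.

Section ChainRing.

Variable R : finComUnitRingType.

(* The ideals of R are the submodules of the regular module R^o.  Unlike
   [idealr_closed], this includes the ideal R itself. *)
Definition is_ideal (I : {set R}) : Prop := submod_closed (mem I : {pred R^o}).

Definition maximal_ideal (M : {set R}) : Prop :=
  [/\ is_ideal M, M != [set: R] &
      forall J : {set R}, is_ideal J -> M \subset J -> J = M \/ J = [set: R]].

Definition local_ring : Prop := exists! M : {set R}, maximal_ideal M.

Definition chain_ring : Prop :=
  local_ring /\
  forall I J : {set R}, is_ideal I -> is_ideal J -> I \subset J \/ J \subset I.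

End ChainRing.

Section Equivalence.

Variable R : finComUnitRingType.

Definition B1 (b : {poly R}) : Prop :=
  exists b1 b0 : R,
    [/\ b1 \is a GRing.unit, b0 \is a GRing.unit & b = b1 *: 'X + b0%:P].

(* Only meaningful for polynomials of degree at most 1. *)
Definition star (a b : {poly R}) : {poly R} :=
  (a`_1 * b`_1) *: 'X + (a`_0 * b`_0)%:P.

(* The neutral element 'X + 1 is the value at N = 0. *)
Definition star_exp (b : {poly R}) (N : nat) : {poly R} :=
  iterop N star b ('X + 1).

(* 'X^n - c is monic of size n.+1 > 1 when c has degree < n and 0 < n, so that
   {poly %/ 'X^n - c} is then the genuine quotient, whose elements are the
   representatives of degree < n. *)
Definition hamming_weight (h : {poly R}) (f : {poly %/ h}) : nat :=
  count (fun c : R => c != 0) (f : {poly R}).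

Definition hamming_dist (h : {poly R}) (f g : {poly %/ h}) : nat :=
  hamming_weight (f - g).

Definition n_isometric (n : nat) (a b : {poly R}) : Prop :=
  exists phi : {lrmorphism {poly %/ 'X^n - a} -> {poly %/ 'X^n - b}},
    bijective phi /\
    forall f g, hamming_dist (phi f) (phi g) = hamming_dist f g.

(* The map f(x) |-> f(alpha x) is required to be well defined on residue
   classes: phi sends the class of every polynomial f, not only of those of
   degree < n, to the class of f(alpha x). *)
Definition n_equivalent (n : nat) (a b : {poly R}) : Prop :=
  exists2 alpha : R, alpha \is a GRing.unit &
  exists phi : {lrmorphism {poly %/ 'X^n - a} -> {poly %/ 'X^n - b}},
    bijective phi /\
    forall f : {poly R},
      phi (in_qpoly ('X^n - a) f) = in_qpoly ('X^n - b) (f \Po (alpha *: 'X)).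

End Equivalence.

(* Main.v *)
(** An isometry phi preserves weights, so phi(x) = alpha x^k, where alpha is a
    unit since the multiples of x by nonzero scalars are nonzero, and 0 < k
    since phi is injective.  Applying phi to x^n = a1 x + a0 and reducing
    x^(kn) to b(x)^k, which has degree k < n, gives the identity of polynomials
    alpha^n (b1 X + b0)^k = a1 alpha X^k + a0.  The vanishing of the middle
    coefficients forces k to be a power of p, and the two extreme coefficients
    say that f(x) |-> f(alpha x) maps x^n - a(x) to alpha^n times
    x^n - (b1^k x + b0^k). *)

Require Import Defs.
From HB Require Import structures.
From mathcomp Require Import all_boot all_order all_algebra.

Set Implicit Arguments.
Unset Strict Implicit.
Unset Printing Implicit Defensive.

Import GRing.Theory.
Local Open Scope ring_scope.

(** * Polynomials with a single nonzero coefficient; regular elements of a finite ring *)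

Lemma count_eq1_nth (T : Type) (x0 : T) (P : pred T) (s : seq T) :
  count P s = 1%N ->
  exists2 k, (k < size s)%N &
    forall j, (j < size s)%N -> P (nth x0 s j) = (j == k).
Proof.
elim: s => [//|x s IHs] /=; have [Px|Px] := boolP (P x).
  rewrite add1n => -[] /eqP; rewrite -leqn0 leqNgt -has_count -all_predC.
  move=> /(all_nthP x0) sN.
  by exists 0%N => // -[|j] // lt_j; apply/negbTE/sN.
rewrite add0n => /IHs[k lt_ks nthP]; exists k.+1 => // -[|j] /= lt_j.
  exact/negbTE.
by rewrite nthP.
Qed.

Lemma poly_weight1 (R : nzRingType) (f : {poly R}) :
  count (fun c : R => c != 0) f = 1%N ->
  exists2 k, (k < size f)%N & f = f`_k *: 'X^k.
Proof.
move=> /(count_eq1_nth 0)[k lt_kf coef_f]; exists k => //.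
apply/polyP=> j; rewrite coefZ coefXn.
have [lt_jf|le_fj] := ltnP j (size f); last first.
  by rewrite nth_default // gtn_eqF ?mulr0 // (leq_trans lt_kf).
have := coef_f j lt_jf; case: (eqVneq j k) => [->|_]; first by rewrite mulr1.
by rewrite mulr0 => /negbFE/eqP.
Qed.

Lemma weight_ZXn (R : nzRingType) (c : R) (k : nat) :
  count (fun x : R => x != 0) (c *: 'X^k : {poly R}) = (c != 0) :> nat.
Proof.
have [->|nz_c] := eqVneq c 0; first by rewrite scale0r polyseq0.
rewrite -mul_polyC polyseqMXn ?polyC_eq0 // polyseqC nz_c.
by elim: k => [|k IHk] /=; rewrite ?nz_c // eqxx.
Qed.

(** Multiplication by [x] is an injective self-map of a finite set, hence bijective; the preimage of
    1 is the inverse. *)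
Lemma fin_mulr_reg_unit (R : finComUnitRingType) (x : R) :
  (forall y, y * x = 0 -> y = 0) -> x \is a GRing.unit.
Proof.
move=> x_reg; have /injF_bij[g _ gK] : injective ( *%R^~ x).
  by move=> y z /eqP; rewrite -subr_eq0 -mulrBl => /eqP/x_reg/subr0_eq.
by apply/unitrPr; exists (g 1); rewrite mulrC gK.
Qed.

(** * Substitution of [alpha *: 'X] between quotients of the polynomial ring *)

Section Substitution.

Variables (R : comUnitRingType) (h g : {poly R}) (alpha : R).

(* The argument does not occur in the body: it is there so that the morphism
   structures, which depend on it, can be inferred. *)
Definition qpoly_subst of in_qpoly g (mk_monic h \Po (alpha *: 'X)) = 0 :=
  fun f : {poly %/ h} => in_qpoly g ((f : {poly R}) \Po (alpha *: 'X)).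

Hypothesis hg0 : in_qpoly g (mk_monic h \Po (alpha *: 'X)) = 0.

Local Notation subst := (qpoly_subst hg0).

(** Division by the monic [mk_monic h] splits [f] into its remainder and a multiple of [mk_monic h],
    which [hg0] kills after substitution. This is the well-definedness on residue classes that
    [n_equivalent] demands. *)
Lemma qpoly_substE (f : {poly R}) :
  subst (in_qpoly h f) = in_qpoly g (f \Po (alpha *: 'X)).
Proof.
rewrite {2}(Pdiv.RingMonic.rdivp_eq (monic_mk_monic h) f).
by rewrite comp_polyD comp_polyM in_qpolyD in_qpolyM hg0 mulr0 add0r.
Qed.

Fact qpoly_subst_is_linear : linear subst.
Proof.
move=> c f f'; rewrite /qpoly_subst /= comp_polyD comp_polyZ.
by rewrite in_qpolyD in_qpolyZ.
Qed.

Fact qpoly_subst_is_monoid_morphism : monoid_morphism subst.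
Proof.
split=> [|f f']; first by rewrite -in_qpoly1 qpoly_substE rmorph1 in_qpoly1.
by rewrite -[LHS]/(subst (in_qpoly h (_ * _))) qpoly_substE comp_polyM in_qpolyM.
Qed.

HB.instance Definition _ :=
  GRing.isSemilinear.Build R {poly %/ h} {poly %/ g} _ subst
    (GRing.semilinear_linear qpoly_subst_is_linear).
HB.instance Definition _ :=
  GRing.isMonoidMorphism.Build {poly %/ h} {poly %/ g} subst
    qpoly_subst_is_monoid_morphism.

Definition qpoly_subst_lrmorphism : {lrmorphism {poly %/ h} -> {poly %/ g}} :=
  subst.

End Substitution.

Lemma in_qpolyK (R : nzRingType) (h : {poly R}) (f : {poly %/ h}) :
  in_qpoly h f = f.
Proof. by apply/val_inj/in_qpoly_small/size_mk_monic. Qed.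

Lemma in_qpoly_mk_monic (R : nzRingType) (h : {poly R}) :
  in_qpoly h (mk_monic h) = 0.
Proof. by apply/val_inj/Pdiv.RingMonic.rmodpp/monic_mk_monic. Qed.

Lemma qpoly_substK (R : comUnitRingType) (h g : {poly R}) (alpha : R)
    (hg0 : in_qpoly g (mk_monic h \Po (alpha *: 'X)) = 0)
    (gh0 : in_qpoly h (mk_monic g \Po (alpha^-1 *: 'X)) = 0) :
  alpha \is a GRing.unit -> cancel (qpoly_subst hg0) (qpoly_subst gh0).
Proof.
move=> Ualpha f; rewrite qpoly_substE -comp_polyA comp_polyZ comp_polyX.
by rewrite scalerA divrr // scale1r comp_polyXr in_qpolyK.
Qed.

(** * Quotients by x^n - (c1 x + c0): scaling relations and binomial powers *)

(** [mk_monic] falls back to ['X] on a polynomial that is not monic of positive degree; the bounds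
    on [n] and [size c] exclude this case. *)
Lemma mk_monic_XnsubC (R : nzRingType) (n : nat) (c : {poly R}) :
  (0 < n)%N -> (size c <= n)%N -> mk_monic ('X^n - c) = 'X^n - c.
Proof.
move=> n_gt0 le_cn; have lt_c : (size (- c) < size ('X^n : {poly R}))%N.
  by rewrite size_polyN size_polyXn.
rewrite /mk_monic size_polyDl // size_polyXn ltnS n_gt0.
by rewrite monicE lead_coefDl // lead_coefXn eqxx.
Qed.

Lemma size_linear_leq (R : nzRingType) (c1 c0 : R) :
  (size (c1 *: 'X + c0%:P)%R <= 2)%N.
Proof.
by rewrite -mul_polyC size_MXaddC; case: ifP; rewrite // ltnS size_polyC leq_b1.
Qed.

Lemma mk_monic_XnsubC_linear (R : nzRingType) (n : nat) (c1 c0 : R) :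
  (2 <= n)%N ->
  mk_monic ('X^n - (c1 *: 'X + c0%:P)) = 'X^n - (c1 *: 'X + c0%:P).
Proof.
move=> n_ge2; apply: mk_monic_XnsubC; first exact: ltnW.
exact: leq_trans (size_linear_leq _ _) n_ge2.
Qed.

(** The two relations say that substituting [alpha *: 'X] in the first modulus gives [alpha ^+ n]
    times the second one. *)
Lemma in_qpoly_XnsubC_linear_scale (R : comUnitRingType) (n : nat)
    (a1 a0 c1 c0 alpha : R) :
  (2 <= n)%N -> alpha ^+ n * c1 = a1 * alpha -> alpha ^+ n * c0 = a0 ->
  in_qpoly ('X^n - (c1 *: 'X + c0%:P))
    (mk_monic ('X^n - (a1 *: 'X + a0%:P)) \Po (alpha *: 'X)) = 0.
Proof.
move=> n_ge2 eq1 eq0; rewrite mk_monic_XnsubC_linear //.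
have -> : ('X^n - (a1 *: 'X + a0%:P)) \Po (alpha *: 'X)
          = alpha ^+ n *: mk_monic ('X^n - (c1 *: 'X + c0%:P)).
  rewrite mk_monic_XnsubC_linear // comp_polyB comp_polyD comp_polyZ comp_polyX.
  rewrite comp_polyC rmorphXn /= comp_polyX exprZn scalerBr scalerDr !scalerA.
  by rewrite -eq1 -eq0 scale_polyC.
by rewrite in_qpolyZ in_qpoly_mk_monic scaler0.
Qed.

(** The relations are symmetric: they also hold for [alpha^-1] with [a] and [c] exchanged, so
    substitution of [alpha^-1 *: 'X] is well defined and inverts the map. *)
Lemma n_equivalent_linear (R : finComUnitRingType) (n : nat)
    (a1 a0 c1 c0 alpha : R) :
  (2 <= n)%N -> alpha \is a GRing.unit ->
  alpha ^+ n * c1 = a1 * alpha -> alpha ^+ n * c0 = a0 ->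
  n_equivalent n (a1 *: 'X + a0%:P) (c1 *: 'X + c0%:P).
Proof.
move=> n_ge2 Ualpha eq1 eq0.
have ac0 := in_qpoly_XnsubC_linear_scale n_ge2 eq1 eq0.
have eq1V : alpha^-1 ^+ n * a1 = c1 * alpha^-1.
  apply: (mulIr Ualpha); rewrite mulrVK // -mulrA -eq1 exprVn.
  by rewrite mulKr ?unitrX.
have eq0V : alpha^-1 ^+ n * a0 = c0 by rewrite -eq0 exprVn mulKr ?unitrX.
have ca0 := in_qpoly_XnsubC_linear_scale n_ge2 eq1V eq0V.
(* Undoing the substitution by [alpha^-1] involves [alpha^-1^-1], which equals [alpha] only up to
   rewriting, so the vanishing is restated in that form. *)
have ca0K : in_qpoly ('X^n - (c1 *: 'X + c0%:P))
    (mk_monic ('X^n - (a1 *: 'X + a0%:P)) \Po (alpha^-1^-1 *: 'X)) = 0.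
  by rewrite invrK.
exists alpha => //; exists (qpoly_subst_lrmorphism ac0).
split; last exact: qpoly_substE.
exists (qpoly_subst ca0); first exact: qpoly_substK.
move=> f; rewrite -[RHS](qpoly_substK ca0 ca0K) ?unitrV //.
by rewrite /= /qpoly_subst invrK.
Qed.

(* Write k = q * m with q the p-part of k: then b ^+ k is the m-th power of
   b1 ^+ q X^q + b0 ^+ q, whose X^q coefficient is m times a unit. *)
Lemma linear_expr_binomial_pnat (R : comUnitRingType) (p k : nat) (b1 b0 : R)
    (c1 c0 : R) :
  p \in [pchar R] -> (0 < k)%N ->
  b1 \is a GRing.unit -> b0 \is a GRing.unit ->
  (b1 *: 'X + b0%:P) ^+ k = c1 *: 'X^k + c0%:P -> p.-nat k.
Proof.
move=> pcharR k_gt0 Ub1 Ub0; set q := (k`_p)%N; set m := (k`_p^')%N.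
have kE : k = (q * m)%N by rewrite partnC.
have q_gt0 : (0 < q)%N by rewrite part_gt0.
have qchar : [pchar {poly R}].-nat q.
  apply: sub_in_pnat (part_pnat p k) => r _ /eqP->.
  by rewrite pchar_poly.
rewrite [in LHS]kE exprM exprDn_pchar // exprZn -rmorphXn /=.
set u := b1 ^+ q; set v := b0 ^+ q => /(congr1 (fun f : {poly R} => f`_q)).
(* Seen as a composition with ['X^q], the m-th power has as its coefficient at [q] the coefficient
   at 1 of [(u *: 'X + v%:P) ^+ m]. *)
have -> : u *: 'X^q + v%:P = (u *: 'X + v%:P) \Po 'X^q.
  by rewrite comp_polyD comp_polyZ comp_polyX comp_polyC.
rewrite -rmorphXn /= coef_comp_poly_Xn // dvdnn divnn q_gt0.
rewrite coefD coefZ coefXn coefC (gtn_eqF q_gt0) addr0.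
(* The coefficient at 1 is the value of the derivative at 0. *)
have -> : ((u *: 'X + v%:P) ^+ m)`_1 = v ^+ m.-1 * u *+ m.
  have := coef_deriv ((u *: 'X + v%:P) ^+ m) 0.
  rewrite mulr1n => <-; rewrite deriv_exp derivD derivZ derivX derivC addr0.
  rewrite coefMn -scalerAl mul1r coefZ -horner_coef0.
  by rewrite !hornerE mulrC.
(* If [q] differs from [k], the right-hand side has no term in ['X^q]; then [m] vanishes in [R], so
   [p] divides the p'-part of [k], which is absurd. *)
have [qk _|neq_qk] := eqVneq q k; first by rewrite -qk; exact: part_pnat.
rewrite mulr0 => /eqP; rewrite -mulr_natl mulrC => /eqP eq0.
have Uvu : v ^+ m.-1 * u \is a GRing.unit by rewrite unitrM !unitrX.
have /eqP : m%:R = 0 :> R by apply: (mulrI Uvu); rewrite eq0 mulr0.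
rewrite -(dvdn_pcharf pcharR) => dvd_pm.
have /pnatP/(_ p (pcharf_prime pcharR) dvd_pm) := part_pnat p^' k.
by rewrite !inE eqxx => /(_ (part_gt0 _ _)).
Qed.

(** * The image of the class of x under an isometry *)

Lemma size_mk_monic_XnsubC_linear (R : nzRingType) (n : nat) (c1 c0 : R) :
  (2 <= n)%N -> size (mk_monic ('X^n - (c1 *: 'X + c0%:P))) = n.+1.
Proof.
move=> n_ge2; rewrite mk_monic_XnsubC_linear // size_polyDl size_polyXn //.
by rewrite size_polyN (leq_ltn_trans (size_linear_leq _ _)).
Qed.

Lemma isometry_qX (R : finComUnitRingType) (n : nat) (a1 a0 b1 b0 : R)
    (phi : {lrmorphism {poly %/ 'X^n - (a1 *: 'X + a0%:P)} ->
                       {poly %/ 'X^n - (b1 *: 'X + b0%:P)}}) :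
  (2 <= n)%N -> injective phi ->
  (forall f g, hamming_dist (phi f) (phi g) = hamming_dist f g) ->
  exists (k : nat) (alpha : R),
    [/\ (0 < k < n)%N, alpha \is a GRing.unit &
        phi 'qX = alpha *: in_qpoly _ 'X^k].
Proof.
move=> n_ge2 phi_inj phi_dist.
have qXE : qpolyX ('X^n - (a1 *: 'X + a0%:P)) = 'X :> {poly R}.
  by rewrite in_qpoly_small // size_polyX size_mk_monic_XnsubC_linear.
have weightE f : hamming_weight (phi f) = hamming_weight f.
  by rewrite -[phi f]subr0 -[f in RHS]subr0 -(raddf0 phi); exact: phi_dist.
have [|k lt_k phiXE] := @poly_weight1 R (phi 'qX).
  rewrite -[LHS]/(hamming_weight _) weightE /hamming_weight qXE.
  by rewrite -['X]scale1r -['X]expr1 weight_ZXn oner_eq0.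
have lt_kn : (k < n)%N.
  rewrite -ltnS -(size_mk_monic_XnsubC_linear b1 b0 n_ge2).
  exact: leq_ltn_trans lt_k (size_mk_monic _).
set alpha := _`_k in phiXE.
have {}phiXE : phi 'qX = alpha *: in_qpoly _ 'X^k.
  apply: val_inj; rewrite /= Pdiv.Ring.rmodp_small //.
  by rewrite size_polyXn size_mk_monic_XnsubC_linear // ltnS ltnW.
exists k, alpha; split=> //.
  (* For [k = 0], [phi] would send both x and the constant [alpha] to [alpha]; injectivity and the
     coefficient at 1 then give 1 = 0. *)
  rewrite lt_kn andbT lt0n; apply/eqP=> k0; move: phiXE.
  rewrite k0 in_qpoly1 -(rmorph1 phi) -linearZ => /phi_inj.
  move/(congr1 (fun f : {poly %/ _} => (f : {poly R})`_1)).
  rewrite qXE coefX poly_of_qpolyZ coefZ coefC mulr0 => /eqP.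
  by rewrite oner_eq0.
apply: fin_mulr_reg_unit => y y0.
have /phi_inj : phi (y *: 'qX) = phi 0.
  by rewrite linearZ /= phiXE scalerA y0 scale0r raddf0.
move/(congr1 (fun f : {poly %/ _} => (f : {poly R})`_1)).
by rewrite poly_of_qpolyZ qXE coefZ coefX coef0 mulr1.
Qed.

Lemma qX_exp_linear (R : comNzRingType) (n : nat) (c1 c0 : R) :
  (2 <= n)%N ->
  (qpolyX ('X^n - (c1 *: 'X + c0%:P)) : {poly %/ _}) ^+ n
  = c1 *: 'qX + c0%:A.
Proof.
move=> n_ge2; set h := 'X^n - _.
have hE : 'X^n = mk_monic h + (c1 *: 'X + c0 *: 1).
  by rewrite mk_monic_XnsubC_linear // -[c0 *: 1]/c0%:A alg_polyC subrK.
rewrite -rmorphXn hE rmorphD /= in_qpoly_mk_monic add0r.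
by rewrite in_qpolyD !in_qpolyZ in_qpoly1.
Qed.

Lemma lrmorph_exp_linear (R : nzRingType) (A B : lalgType R)
    (phi : {lrmorphism A -> B}) (n : nat) (a1 a0 : R) (x : A) :
  x ^+ n = a1 *: x + a0%:A -> phi x ^+ n = a1 *: phi x + a0%:A.
Proof. by move=> xE; rewrite -rmorphXn xE rmorphD /= !linearZ /= rmorph1. Qed.

(** Both sides have degree at most [k < n], so each is its own representative and the equality of
    classes is one of polynomials. *)
Lemma isometry_linear_expr (R : comNzRingType) (n k : nat)
    (a1 a0 b1 b0 alpha : R)
    (phi : {lrmorphism {poly %/ 'X^n - (a1 *: 'X + a0%:P)} ->
                       {poly %/ 'X^n - (b1 *: 'X + b0%:P)}}) :
  (2 <= n)%N -> (k < n)%N -> phi 'qX = alpha *: in_qpoly _ 'X^k ->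
  alpha ^+ n *: (b1 *: 'X + b0%:P) ^+ k = (a1 * alpha) *: 'X^k + a0%:P.
Proof.
move=> n_ge2 lt_kn phiX.
have := lrmorph_exp_linear phi (qX_exp_linear a1 a0 n_ge2).
rewrite phiX; set h := 'X^n - (b1 *: 'X + b0%:P) in phi phiX *.
have hE : 'X^n = mk_monic h + (b1 *: 'X + b0%:P).
  by rewrite mk_monic_XnsubC_linear // subrK.
have small_size (f : {poly R}) :
    (size f <= k.+1)%N -> in_qpoly h f = f :> {poly R}.
  move=> le_fk; apply: in_qpoly_small.
  by rewrite size_mk_monic_XnsubC_linear // ltnS (leq_trans le_fk).
(* As (x^k)^n = (x^n)^k, the class of x^n can be replaced by that of [b] before taking the k-th
   power. *)
have -> : (alpha *: in_qpoly h 'X^k) ^+ n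
          = in_qpoly h (alpha ^+ n *: (b1 *: 'X + b0%:P) ^+ k).
  rewrite exprZn in_qpolyZ -rmorphXn /= exprAC hE 2!rmorphXn rmorphD /=.
  by rewrite in_qpoly_mk_monic add0r.
have -> : a1 *: (alpha *: in_qpoly h 'X^k) + a0%:A
          = in_qpoly h ((a1 * alpha) *: 'X^k + a0%:P).
  by rewrite -alg_polyC in_qpolyD !in_qpolyZ in_qpoly1 scalerA.
move/(congr1 (@polyn _ _)); rewrite !small_size //.
  apply: leq_trans (size_polyD _ _) _; rewrite geq_max.
  rewrite (leq_trans (size_scale_leq _ _)) ?size_polyXn //.
  by rewrite (leq_trans (size_polyC_leq1 _)).
apply: leq_trans (size_scale_leq _ _) _.
apply: leq_trans (size_poly_exp_leq _ _) _; rewrite ltnS.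
by rewrite -[leqRHS]mul1n leq_mul2r -subn1 leq_subLR size_linear_leq orbT.
Qed.

(** * Star powers and the conclusion *)

Lemma star_exp_linear (R : finComUnitRingType) (b1 b0 : R) (N : nat) :
  star_exp (b1 *: 'X + b0%:P) N = b1 ^+ N *: 'X + (b0 ^+ N)%:P.
Proof.
have coef1E (c1 c0 : R) : (c1 *: 'X + c0%:P)`_1 = c1.
  by rewrite coefD coefZ coefX coefC mulr1 addr0.
have coef0E (c1 c0 : R) : (c1 *: 'X + c0%:P)`_0 = c0.
  by rewrite coefD coefZ coefX coefC mulr0 add0r.
case: N => [|N]; first by rewrite /star_exp /= !expr0 scale1r.
rewrite /star_exp iteropS; elim: N => [|N IHN]; first by rewrite !expr1.
by rewrite iterS IHN /star !coef1E !coef0E -!exprS.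
Qed.

Theorem theorem7 (R : finComUnitRingType) (p n : nat)
    (hR : chain_ring R) (hp : p \in [pchar R]) (hn : (2 <= n)%N)
    (a b : {poly R}) (ha : B1 a) (hb : B1 b)
    (hab : n_isometric n a b) :
  n_equivalent n a b \/
  exists l : nat,
    [/\ (1 <= l)%N, (p ^ l < n)%N & n_equivalent n a (star_exp b (p ^ l))].
Proof.
have [a1 [a0 [_ _ aE]]] := ha; have [b1 [b0 [Ub1 Ub0 bE]]] := hb.
have [phi [/bij_inj phi_inj phi_dist]] := hab; subst a b.
have [k [alpha [/andP[k_gt0 lt_kn] Ualpha phiX]]] :=
  isometry_qX hn phi_inj phi_dist.
have bkE := isometry_linear_expr hn lt_kn phiX.
have bk : (b1 *: 'X + b0%:P) ^+ k
    = (alpha ^- n * (a1 * alpha)) *: 'X^k + (alpha ^- n * a0)%:P.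
  rewrite -scalerA -scale_polyC -scalerDr -bkE scalerA mulVr ?unitrX //.
  by rewrite scale1r.
have /p_natP[l kE] := linear_expr_binomial_pnat hp k_gt0 Ub1 Ub0 bk.
(* Since [k] is a power of [p], raising to the power [k] is additive in characteristic [p]. *)
have coef_bk i : (b1 ^+ k *: 'X^k + (b0 ^+ k)%:P)`_i
    = (alpha ^- n * (a1 * alpha) *: 'X^k + (alpha ^- n * a0)%:P)`_i.
  rewrite -bk exprDn_pchar ?exprZn ?rmorphXn // kE pnatX.
  apply/orP; left; apply/pnatP; first exact: prime_gt0 (pcharf_prime hp).
  move=> r r_pr; rewrite dvdn_prime2 ?(pcharf_prime hp) // => /eqP->.
  by rewrite pchar_poly.
(* The coefficients at [k] and at 0, distinct positions because [0 < k], are the two scaling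
   relations. *)
have equiv_bk :
    n_equivalent n (a1 *: 'X + a0%:P) (b1 ^+ k *: 'X + (b0 ^+ k)%:P).
  apply: (@n_equivalent_linear _ _ _ _ _ _ alpha) => //.
    have := coef_bk k; rewrite !coefD !coefZ !coefXn !coefC eqxx gtn_eqF //.
    by rewrite !addr0 !mulr1 => ->; rewrite mulVKr ?unitrX.
  have := coef_bk 0; rewrite !coefD !coefZ !coefXn !coefC /= ltn_eqF //.
  by rewrite !mulr0 !add0r => ->; rewrite mulVKr ?unitrX.
(* [l = 0] means [k = 1], where the star power is [b] itself; otherwise [p ^ l < n] is the bound
   [k < n]. *)
case: l kE => [|l] kE; first by left; move: equiv_bk; rewrite kE !expr1.
by right; exists l.+1; rewrite -kE star_exp_linear.
Qed.
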